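(* Let $A_1$ and $A_2$ be Banach algebras and let $\phi: A_1\to A_2$ be a continuous homomorphism with dense range. Write $A_2^*\circ\phi=\{F\circ\phi : F\in A_2^*\}\subseteq A_1^*$. Then the following statements hold. (i) If $A_1$ is cyclically weakly amenable, then $A_2$ is cyclically weakly amenable. (ii) If $A_2^*\circ\phi=A_1^*$ and $A_1$ is cyclically amenable, then $A_2$ is cyclically amenable. (iii) If $A_2^*\circ\phi=A_1^*$ and $A_1$ is weakly amenable, then $A_2$ is weakly amenable. (iv) If $A_1$ is 0-point amenable, then $A_2$ is 0-point amenable.
   Context: For a Banach algebra $A$, the dual $A^*$ is an $A$-bimodule via $\langle F\cdot a,x\rangle=\langle F,ax\rangle$ and $\langle a\cdot F,x\rangle=\langle F,xa\rangle$ for $F\in A^*$, $a,x\in A$. A linear operator $D:A\to A^*$ is a derivation if $D(ab)=D(a)\cdot b+a\cdot D(b)$ for all $a,b\in A$; it is cyclic if $\langle D(a),b\rangle+\langle D(b),a\rangle=0$ for all $a,b\in A$; an inner derivation is one of the form $\mathrm{ad}_F: a\mapsto F\cdot a-a\cdot F$ with $F\in A^*$. $A$ is weakly amenable if every continuous derivation $A\to A^*$ is inner; cyclically weakly amenable if every continuous derivation $A\to A^*$ is cyclic; cyclically amenable if every cyclic derivation $A\to A^*$ is inner. $\Delta(A)$ is the character space of $A$ (nonzero multiplicative linear functionals) and $\Delta_0(A)=\Delta(A)\cup\{0\}$. A continuous point derivation of $A$ at $\varphi\in\Delta_0(A)$ is a continuous linear functional $d$ on $A$ with $d(ab)=d(a)\varphi(b)+\varphi(a)d(b)$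 for all $a,b\in A$. $A$ is 0-point amenable if there is no nonzero continuous point derivation of $A$ at any element of $\Delta_0(A)$. *)

(* Defs.v *)
From HB Require Import structures.
From mathcomp Require Import all_boot all_order all_algebra.
From mathcomp Require Import all_classical all_reals all_analysis.
From mathcomp Require Import complex.

Set Implicit Arguments.
Unset Strict Implicit.
Unset Printing Implicit Defensive.

Import Order.TTheory GRing.Theory Num.Theory.
Import numFieldNormedType.Exports.

Local Open Scope classical_set_scope.
Local Open Scope ring_scope.
Local Open Scope complex_scope.

(* Banach algebras need not have a unit, so the ring structures of ssralg (all
   unital) do not apply: the product is a separate operation [bmul]. *)
HB.mixin Record isBanachAlgebra (K : numFieldType) A
    & CompleteNormedModule K A := {
  bmul : A -> A -> A ;
  bmulA : associative bmul ;
  bmulDl : left_distributive bmul +%R ;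
  bmulDr : right_distributive bmul +%R ;
  bscalerAl : forall (k : K) (a b : A), k *: bmul a b = bmul (k *: a) b ;
  bscalerAr : forall (k : K) (a b : A), k *: bmul a b = bmul a (k *: b) ;
  bnormM : forall a b : A, `|bmul a b| <= `|a| * `|b|
}.

#[short(type="banachAlgType")]
HB.structure Definition BanachAlgebra (K : numFieldType) :=
  {A of CompleteNormedModule K A & isBanachAlgebra K A}.

Notation "a ** b" := (bmul a b) (at level 40, left associativity) : ring_scope.

Section Dual.
Context {R : realType} (A : normedModType R[i]).

Definition dual_pred : {pred A -> R[i]^o} :=
  [pred f : A -> R[i]^o | `[< linear f /\ continuous f >]].

Lemma dual_predP (f : A -> R[i]^o) :
  reflect (linear f /\ continuous f) (f \in dual_pred).
Proof. by rewrite inE; exact: asboolP. Qed.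

Lemma dual_submod_closed : submod_closed dual_pred.
Proof.
split=> [|k f g /dual_predP[lf cf] /dual_predP[lg cg]]; apply/dual_predP; split.
- by move=> a x y; rewrite /= scaler0 addr0.
- exact: cst_continuous.
- move=> a x y; rewrite !fctE lf lg !scalerDr !scalerA (mulrC a k).
  by rewrite addrACA.
- by move=> x; apply: cvgD; [apply: cvgZl_tmp; exact: cf|exact: cg].
Qed.

HB.instance Definition _ :=
  GRing.isSubmodClosed.Build R[i] (A -> R[i]^o) dual_pred dual_submod_closed.

Record dual := Dual { dual_fun :> A -> R[i]^o ; _ : dual_fun \in dual_pred }.

HB.instance Definition _ := [isSub for dual_fun].
HB.instance Definition _ := [Choice of dual by <:].
HB.instance Definition _ := [SubChoice_isSubLmodule of dual by <:].


Lemma dual_linear (F : dual) : linear (F : A -> R[i]^o).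
Proof. by have /dual_predP[] := valP F. Qed.

HB.instance Definition _ (F : dual) :=
  GRing.isLinear.Build R[i] A R[i]^o *:%R (dual_fun F) (dual_linear F).

Lemma dual_continuous (F : dual) : continuous (F : A -> R[i]^o).
Proof. by have /dual_predP[] := valP F. Qed.

Lemma dual_ext (F G : dual) : (forall x, F x = G x) -> F = G.
Proof. by move=> FG; apply/val_inj/funext. Qed.

Lemma dualDE (F G : dual) x : (F + G) x = F x + G x. Proof. by []. Qed.
Lemma dualNE (F : dual) x : (- F) x = - F x. Proof. by []. Qed.
Lemma dualZE (k : R[i]) (F : dual) x : (k *: F) x = k * F x.
Proof. by []. Qed.
Lemma dual0E x : (0 : dual) x = 0. Proof. by []. Qed.

(* Norms of R[i]-normed modules take their values in R[i], whose order is only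
   partial; suprema have to be taken in R. *)
Definition dual_norm (F : dual) : R[i] :=
  (sup [set complex.Re `|F x| | x in [set x : A | `|x| <= 1]])%:C.

Lemma RReN (V : normedModType R[i]) (v : V) :
  (complex.Re `|v|)%:C = `|v| :> R[i].
Proof. by apply: RRe_real; exact: normr_real. Qed.

Lemma dual_bounded (F : dual) :
  exists M : R, forall x : A, `|x| <= 1 -> complex.Re `|F x| <= M.
Proof.
have : {for (0 : A), continuous F}.
  exact: dual_continuous.
move=> /(continuous_linear_bounded (0 : A)) /linear_boundedP /pinfty_ex_gt0[r r0 Fr]; exists (complex.Re r) => x x1.
rewrite -lecR RReN RRe_real ?gtr0_real//.
by rewrite (le_trans (Fr x))// ler_piMr// ltW.
Qed.

Lemma dual_has_sup (F : dual) :
  has_sup [set complex.Re `|F x| | x in [set x : A | `|x| <= 1]].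
Proof.
split; first by exists (complex.Re `|F 0|), 0 => //=; rewrite normr0.
by have [M FM] := dual_bounded F; exists M => _ [x x1 <-]; exact: FM.
Qed.

Lemma ler_dual_norm (F : dual) x : `|F x| <= dual_norm F * `|x|.
Proof.
have [->|x0] := eqVneq x 0; first by rewrite linear0 !normr0 mulr0.
have nx0 : 0 < `|x| by rewrite normr_gt0.
rewrite -ler_pdivrMr//.
have -> : `|F x| / `|x| = `|F (`|x|^-1 *: x)|.
  by rewrite linearZ normrZ ger0_norm ?invr_ge0// mulrC.
rewrite -(RReN (F (_ *: x) : R[i]^o)) lecR; apply: sup_upper_bound; first exact: dual_has_sup.
exists (`|x|^-1 *: x) => //=.
by rewrite normrZ ger0_norm ?invr_ge0// mulVf ?gt_eqF.
Qed.

Lemma dual_norm_le (F : dual) (M : R[i]) :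
  0 <= M -> (forall x, `|F x| <= M * `|x|) -> dual_norm F <= M.
Proof.
move=> M0 FM; rewrite -(RRe_real (ger0_real M0)) lecR.
apply: ge_sup; first by have [] := dual_has_sup F.
move=> _ [x x1 <-]; rewrite -lecR RReN RRe_real ?ger0_real//.
by rewrite (le_trans (FM x))// ler_piMr.
Qed.

Lemma dual_norm_ge0 (F : dual) : 0 <= dual_norm F.
Proof.
have := sup_upper_bound (dual_has_sup F) => /(_ (complex.Re `|F 0|)) h.
rewrite (le_trans (normr_ge0 (F 0)))// -RReN lecR; apply: h.
by exists 0 => //=; rewrite normr0.
Qed.

Lemma dual_normD (F G : dual) :
  dual_norm (F + G) <= dual_norm F + dual_norm G.
Proof.
apply: dual_norm_le => [|x]; first by rewrite addr_ge0// dual_norm_ge0.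
by rewrite dualDE (le_trans (ler_normD _ _))// mulrDl lerD// ler_dual_norm.
Qed.

Lemma dual_normZ (k : R[i]) (F : dual) :
  dual_norm (k *: F) = `|k| * dual_norm F.
Proof.
have le (l : R[i]) (G : dual) : dual_norm (l *: G) <= `|l| * dual_norm G.
  apply: dual_norm_le => [|x]; first by rewrite mulr_ge0// dual_norm_ge0.
  by rewrite dualZE normrM -mulrA ler_wpM2l// ler_dual_norm.
apply/eqP; rewrite eq_le le /=.
have [->|k0] := eqVneq k 0; first by rewrite normr0 mul0r dual_norm_ge0.
rewrite -ler_pdivlMl ?normr_gt0// -normfV.
by rewrite -[X in dual_norm X <= _](scalerK k0) le.
Qed.

Lemma dual_norm_eq0 (F : dual) : dual_norm F = 0 -> F = 0.
Proof.
move=> F0; apply: dual_ext => x; apply/eqP; rewrite -normr_le0.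
by rewrite (le_trans (ler_dual_norm F x))// F0 mul0r.
Qed.

HB.instance Definition _ :=
  Lmodule_isNormed.Build R[i] dual dual_normD dual_normZ dual_norm_eq0.

Lemma dual_normE (F : dual) : `|F| = dual_norm F. Proof. by []. Qed.

End Dual.

Arguments dual_pred {R} A.

Section Bimodule.
Context {R : realType} {A : banachAlgType R[i]}.
Implicit Types (F : dual A) (a b x : A).

Lemma bmull_continuous a : continuous (fun x : A => a ** x).
Proof.
have lin : linear (fun x : A => a ** x).
  by move=> k x y; rewrite bmulDr bscalerAr.
pose f : {linear A -> A} := HB.pack (fun x : A => a ** x)
  (GRing.isLinear.Build R[i] A A *:%R _ lin).
apply: (bounded_linear_continuous (f := f)); apply/bounded_funP => r.
exists (`|a| * r) => x xr; rewrite (le_trans (bnormM _ _))//.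
by rewrite ler_wpM2l.
Qed.

Lemma bmulr_continuous a : continuous (fun x : A => x ** a).
Proof.
have lin : linear (fun x : A => x ** a).
  by move=> k x y; rewrite bmulDl bscalerAl.
pose f : {linear A -> A} := HB.pack (fun x : A => x ** a)
  (GRing.isLinear.Build R[i] A A *:%R _ lin).
apply: (bounded_linear_continuous (f := f)); apply/bounded_funP => r.
exists (r * `|a|) => x xr; rewrite (le_trans (bnormM _ _))//.
by rewrite ler_wpM2r.
Qed.

Lemma dual_ractP F a : (fun x => F (a ** x)) \in dual_pred A.
Proof.
apply/dual_predP; split=> [k x y|x].
  by rewrite bmulDr -bscalerAr linearP.
by apply: continuous_comp; [exact: bmull_continuous|exact: dual_continuous].
Qed.

Lemma dual_lactP a F : (fun x => F (x ** a)) \in dual_pred A.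
Proof.
apply/dual_predP; split=> [k x y|x].
  by rewrite bmulDl -bscalerAl linearP.
apply: (@continuous_comp _ _ _ (fun x => x ** a) F).
  exact: bmulr_continuous.
exact: dual_continuous.
Qed.

(* F . a  and  a . F *)
Definition dual_ract F a : dual A := Dual (dual_ractP F a).
Definition dual_lact a F : dual A := Dual (dual_lactP a F).

Definition derivation (D : A -> dual A) : Prop :=
  forall a b, D (a ** b) = dual_ract (D a) b + dual_lact a (D b).

Definition cyclic_op (D : A -> dual A) : Prop :=
  forall a b, D a b + D b a = 0.

Definition inner (D : A -> dual A) : Prop :=
  exists F, forall a, D a = dual_ract F a - dual_lact a F.

End Bimodule.

Section Amenability.
Context {R : realType} (A : banachAlgType R[i]).

Definition weakly_amenable : Prop :=
  forall D : {linear A -> dual A}, derivation D -> continuous D -> inner D.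

Definition cyclically_weakly_amenable : Prop :=
  forall D : {linear A -> dual A}, derivation D -> continuous D -> cyclic_op D.

(* No continuity is required of D here: a cyclic linear operator from A to its
   dual is automatically continuous, by the closed graph theorem. *)
Definition cyclically_amenable : Prop :=
  forall D : {linear A -> dual A}, derivation D -> cyclic_op D -> inner D.

Definition character_space : set (A -> R[i]^o) :=
  [set f | [/\ linear f, (forall a b, f (a ** b) = f a * f b) & f != 0]].

Definition character_space0 : set (A -> R[i]^o) :=
  character_space `|` [set 0].

Definition point_derivation (f : A -> R[i]^o) (d : dual A) : Prop :=
  forall a b, d (a ** b) = d a * f b + f a * d b.

Definition zero_point_amenable : Prop :=
  ~ exists f (d : dual A),
      [/\ character_space0 f, point_derivation f d & d != 0].

End Amenability.

(* Main.v *)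
(* The pullback [F |-> F \o phi] is a bounded linear map intertwining the module
   actions, so conjugating a derivation of A2 by phi gives a derivation
   [a |-> D (phi a) \o phi] of A1.  What the hypothesis on A1 says about the
   latter is an identity on the range of phi, which extends to A2 by density and
   continuity.  In (ii) D is not assumed continuous: D(phi a) = ad_F(phi a)
   extends in the second variable only, and cyclicity then exchanges the two
   variables.  In (iv) the case f \o phi = 0 is allowed since 0 belongs to
   Delta_0(A1), so no automatic continuity of characters is needed. *)
From HB Require Import structures.
Require Import Defs.
From mathcomp Require Import all_boot all_order all_algebra.
From mathcomp Require Import all_classical all_reals all_analysis.
From mathcomp Require Import complex.
Import Order.TTheory GRing.Theory Num.Theory.
Import numFieldNormedType.Exports.
Local Open Scope classical_set_scope.
Local Open Scope ring_scope.
Local Open Scope complex_scope.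

(** Since [V] is Hausdorff, the set where [h] does not vanish is open; if nonempty, it would meet
    [S]. *)
Lemma dense_eq0 (K : numFieldType) (T : topologicalType) (V : normedModType K)
    (S : set T) (h : T -> V) :
  dense S -> continuous h -> (forall x, S x -> h x = 0) -> forall x, h x = 0.
Proof.
move=> dS ch h0 x; apply: contrapT => hx.
have oU : open (h @^-1` (~` [set 0])).
  apply: open_comp => [y _|]; first exact: ch.
  by apply/closed_openC/accessible_closed_set1/hausdorff_accessible/norm_hausdorff.
have /dS /(_ oU)[y [hy /h0]] : h @^-1` (~` [set 0]) !=set0 by exists x.
exact: hy.
Qed.

Arguments dense_eq0 {K T V S h}.

Section DenseRange.
Context {R : realType} {T : Type} {A B : normedModType R[i]} {phi : T -> A}.
Hypothesis phi_dense : dense (range phi).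

Lemma dual_ext_dense (F G : dual A) :
  (forall t, F (phi t) = G (phi t)) -> F = G.
Proof.
move=> FG; apply: dual_ext => x; apply/eqP; rewrite -subr_eq0 -dualNE -dualDE.
apply/eqP; apply: (dense_eq0 (h := F - G : A -> R[i]^o) phi_dense).
  exact: dual_continuous.
by move=> _ [t _ <-]; rewrite dualDE dualNE FG subrr.
Qed.

End DenseRange.

Arguments dual_ext_dense {R T A phi}.

(** Bounded by [|F x| <= |F| * |x|]. This gives continuity of [y |-> D y x] for continuous [D], so
    that density can be used in the first variable. *)
Lemma dual_eval_continuous (R : realType) (A : normedModType R[i]) (x : A) :
  continuous (fun F : dual A => F x : R[i]^o).
Proof.
have lin : linear (fun F : dual A => F x : R[i]^o) by [].
pose f : {linear dual A -> R[i]^o} := HB.pack (fun F : dual A => F x : R[i]^o)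
  (GRing.isLinear.Build R[i] (dual A) R[i]^o *:%R _ lin).
apply: (bounded_linear_continuous (f := f)); apply/bounded_funP => r.
exists (r * `|x|) => F Fr; rewrite (le_trans (ler_dual_norm F x))//.
by rewrite ler_wpM2r.
Qed.

Section Pullback.
Context {R : realType} {A1 A2 : normedModType R[i]} (phi : {linear A1 -> A2}).
Hypothesis phi_cont : continuous phi.

Lemma pullbackP (F : dual A2) : (F : A2 -> R[i]^o) \o phi \in dual_pred A1.
Proof.
apply/dual_predP; split=> [k x y|x]; first by rewrite /= !linearP.
by apply: continuous_comp; [exact: phi_cont|exact: dual_continuous].
Qed.

Definition pullback (F : dual A2) : dual A1 := Dual (pullbackP F).

Lemma pullback_linear : linear pullback.
Proof. by move=> k F G; apply: dual_ext. Qed.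

HB.instance Definition _ :=
  GRing.isLinear.Build R[i] (dual A2) (dual A1) *:%R pullback pullback_linear.

Lemma pullback_continuous : continuous pullback.
Proof.
have /(continuous_linear_bounded (0 : A1)) : {for (0 : A1), continuous phi}.
  exact: phi_cont.
move=> /linear_boundedP /pinfty_ex_gt0[C C0 phiC].
apply: bounded_linear_continuous; apply/bounded_funP => r.
(* If [r] is not nonnegative, no functional has norm at most [r], and any bound will do. *)
have [r0|r0] := boolP (0 <= r); last first.
  by exists 0 => F Fr; rewrite (le_trans (normr_ge0 F) Fr) in r0.
exists (r * C) => F Fr; apply: dual_norm_le => [|x].
  by rewrite mulr_ge0// ltW.
rewrite (le_trans (ler_dual_norm F (phi x)))// -mulrA ler_pM ?dual_norm_ge0//.
Qed.

End Pullback.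

Section DenseHomomorphism.
Context {R : realType} {A1 A2 : banachAlgType R[i]} (phi : {linear A1 -> A2}).
Hypothesis phiM : forall a b : A1, phi (a ** b) = phi a ** phi b.
Hypothesis phi_cont : continuous phi.
Hypothesis phi_dense : dense (range phi).

Definition pullback_op (D : A2 -> dual A2) : A1 -> dual A1 :=
  pullback phi phi_cont \o D \o phi.

Lemma pullback_op_linear (D : {linear A2 -> dual A2}) : linear (pullback_op D).
Proof. by move=> k x y; rewrite /pullback_op /= !linearP. Qed.

HB.instance Definition _ (D : {linear A2 -> dual A2}) :=
  GRing.isLinear.Build R[i] A1 (dual A1) *:%R (pullback_op D)
    (pullback_op_linear D).

Lemma pullback_op_continuous (D : A2 -> dual A2) :
  continuous D -> continuous (pullback_op D).
Proof.
move=> cD x; apply: continuous_comp; first exact: phi_cont.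
by apply: continuous_comp; [exact: cD|exact: pullback_continuous].
Qed.

Lemma pullback_op_derivation (D : A2 -> dual A2) :
  derivation D -> derivation (pullback_op D).
Proof.
move=> dD a b; apply: dual_ext => x.
by rewrite dualDE /= !phiM dD.
Qed.

Lemma pullback_op_cyclic (D : A2 -> dual A2) :
  cyclic_op D -> cyclic_op (pullback_op D).
Proof. by move=> cD a b; exact: cD. Qed.

(** Density is applied twice, to one variable at a time with the other held fixed. *)
Lemma cyclic_of_pullback_op (D : A2 -> dual A2) :
  continuous D -> cyclic_op (pullback_op D) -> cyclic_op D.
Proof.
move=> cD cycD.
have cont b : continuous (fun y => D y b + D b y : R[i]^o).
  move=> y; apply: cvgD; last exact: dual_continuous.
  apply: (@continuous_comp _ _ _ D (fun F : dual A2 => F b : R[i]^o)).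
    exact: cD.
  exact: dual_eval_continuous.
move=> a b; apply: (dense_eq0 phi_dense (cont b)) => _ [x _ <-].
(* The expression is symmetric in its two variables, so [cont] also serves for the second one. *)
rewrite addrC; apply: (dense_eq0 phi_dense (cont (phi x))) => _ [y _ <-].
exact: cycD.
Qed.

(** The functional [G] implementing the pulled-back derivation factors as [F \o phi]. The two
    functionals on [A2] then agree on the range of [phi], hence everywhere. *)
Lemma inner_pullback_op (D : A2 -> dual A2) :
  [set (F : A2 -> R[i]^o) \o phi | F in [set: dual A2]] =
  [set (G : A1 -> R[i]^o) | G in [set: dual A1]] ->
  inner (pullback_op D) ->
  exists F, forall a, D (phi a) = dual_ract F (phi a) - dual_lact (phi a) F.
Proof.
move=> full [G DG].
have : [set (G : A1 -> R[i]^o) | G in [set: dual A1]] G by exists G.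
rewrite -full => -[F _ FG]; exists F => a.
apply: (dual_ext_dense phi_dense) => x.
have : pullback_op D a x = (dual_ract G a - dual_lact a G) x by rewrite DG.
by rewrite !dualDE !dualNE /= -FG /= !phiM.
Qed.

Lemma inner_of_cyclic_dense (D : A2 -> dual A2) (F : dual A2) :
  cyclic_op D ->
  (forall a, D (phi a) = dual_ract F (phi a) - dual_lact (phi a) F) -> inner D.
Proof.
move=> cD DF; exists F => a; apply: (dual_ext_dense phi_dense) => x.
(* Cyclicity turns [D a (phi x)] into [- D (phi x) a], where [DF] applies. *)
move/eqP: (cD a (phi x)); rewrite addr_eq0 => /eqP ->.
by rewrite DF !dualDE !dualNE /= opprB.
Qed.

Lemma inner_of_continuous_dense (D : A2 -> dual A2) (F : dual A2) :
  continuous D ->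
  (forall a, D (phi a) = dual_ract F (phi a) - dual_lact (phi a) F) -> inner D.
Proof.
move=> cD DF; exists F => a; apply: dual_ext => x.
(* The value of [ad_F y] at [x] is [F (y ** x) - F (x ** y)], written here through functionals of
   [y] so that its continuity in [y] is immediate. *)
pose h y : R[i]^o := D y x - (dual_lact x F y - dual_ract F x y).
suff /eqP : h a = 0 by rewrite subr_eq0 => /eqP.
apply: (dense_eq0 phi_dense) => [y|_ [z _ <-]]; last first.
  by rewrite /h DF subrr.
apply: cvgB.
  apply: (@continuous_comp _ _ _ D (fun G : dual A2 => G x : R[i]^o)).
    exact: cD.
  exact: dual_eval_continuous.
by apply: cvgB; exact: dual_continuous.
Qed.

Lemma character_space0_comp (f : A2 -> R[i]^o) :
  character_space0 f -> character_space0 (f \o phi).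
Proof.
have [->|fphi0] := eqVneq (f \o phi) 0; first by move=> _; right.
move=> [[lf fM _]|->]; last by right.
left; split=> // [k x y|a b]; first by rewrite /= linearP lf.
by rewrite /= phiM fM.
Qed.

End DenseHomomorphism.

Theorem theorem2p1 (R : realType) (A1 A2 : banachAlgType R[i])
    (phi : {linear A1 -> A2})
    (phiM : forall a b : A1, phi (a ** b) = phi a ** phi b)
    (phi_cont : continuous phi)
    (phi_dense : dense (range phi)) :
  let full_pullback :=
    [set (F : A2 -> R[i]^o) \o phi | F in [set: dual A2]] =
    [set (G : A1 -> R[i]^o) | G in [set: dual A1]] in
  [/\ (cyclically_weakly_amenable A1 -> cyclically_weakly_amenable A2),
      (full_pullback -> cyclically_amenable A1 -> cyclically_amenable A2),
      (full_pullback -> weakly_amenable A1 -> weakly_amenable A2)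
    & (zero_point_amenable A1 -> zero_point_amenable A2)].
Proof.
move=> full_pullback; split.
- move=> cwa D dD cD; apply: (cyclic_of_pullback_op _ phi_cont phi_dense _ cD).
  apply: cwa; first exact: pullback_op_derivation.
  exact: pullback_op_continuous.
- move=> full ca D dD cycD.
  have [|F DF] := inner_pullback_op phi phiM phi_cont phi_dense D full.
    apply: ca; first exact: pullback_op_derivation.
    exact: pullback_op_cyclic.
  exact: (inner_of_cyclic_dense phi phi_dense).
- move=> full wa D dD cD.
  have [|F DF] := inner_pullback_op phi phiM phi_cont phi_dense D full.
    apply: wa; first exact: pullback_op_derivation.
    exact: pullback_op_continuous.
  exact: (inner_of_continuous_dense phi phi_dense).
- move=> zpa [f [d [f0 fd d0]]]; apply: zpa.
  exists (f \o phi), (pullback phi phi_cont d); split.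
  + exact: character_space0_comp.
  + by move=> a b; rewrite /= phiM fd.
  (* Dense range makes the pullback injective, so a nonzero [d] stays nonzero. *)
  + apply: contra_neq d0 => d0; apply: (dual_ext_dense phi_dense) => x.
    by rewrite -[LHS]/(pullback phi phi_cont d x) d0.
Qed.
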